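(* Let $(X_i,\kappa_i)$ be a finite digital image, $1 \le i \le v$. Let $X = \prod_{i=1}^v X_i$. If $(X,NP_v(\kappa_1,\ldots,\kappa_v))$ is irreducible, then each $(X_i,\kappa_i)$ is irreducible.
   Context: A digital image is a pair $(X,\kappa)$ where $X \subset \mathbb{Z}^n$ for some $n \in \mathbb{N}$ and $\kappa$ is an adjacency relation (a symmetric, irreflexive binary relation) on $X$; thus it is a simple graph. Write $x \leftrightarrow_\kappa y$ if $x,y$ are $\kappa$-adjacent. A function $f:(X,\kappa)\to(Y,\lambda)$ is $(\kappa,\lambda)$-continuous if $x \leftrightarrow_\kappa x'$ implies $f(x)=f(x')$ or $f(x)\leftrightarrow_\lambda f(x')$. Homotopy: For integers $a\le b$, $[a,b]_{\mathbb{Z}}=\{z\in\mathbb{Z} : a\le z\le b\}$, where $z,z'$ are adjacent iff $|z-z'|=1$. Continuous functions $f,g:(X,\kappa)\to(Y,\lambda)$ are homotopic if there are a positive integer $m$ and $F:X\times[0,m]_{\mathbb{Z}}\to Y$ such that $F(x,0)=f(x)$ and $F(x,m)=g(x)$ for all $x\in X$; for each $x\in X$ the map $t\mapsto F(x,t)$ is continuous (i.e., $F(x,t)$ and $F(x,t+1)$ are equal or adjacent for $0\le t<m$); and for each $t$ the map $x\mapsto F(x,t)$ is $(\kappa,\lambda)$-continuous. Digital images $(X,\kappa)$ and $(Y,\lambda)$ are homotopy equivalent if there are continuous maps $f:X\to Y$, $g:Y\to X$ with $g\circ f$ homotopic to $\mathrm{id}_X$ and $f\circ g$ homotopic to $\mathrm{id}_Y$.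 A finite digital image is reducible if it is homotopy equivalent to a digital image with fewer points; otherwise it is irreducible. Product adjacency: for distinct $x=(x_1,\dots,x_v)$ and $x'=(x_1',\dots,x_v')$ in $X=\prod_{i=1}^v X_i$, with $x_i,x_i'\in X_i$, and $1\le u\le v$, $x$ and $x'$ are $NP_u(\kappa_1,\dots,\kappa_v)$-adjacent iff for at least $1$ and at most $u$ indices $i$ we have $x_i\leftrightarrow_{\kappa_i}x_i'$, and $x_j=x_j'$ for all other indices $j$.
   Formalization: The digital images X_i are assumed nonempty; without this the statement fails, e.g. if X_1 is empty and X_2 is a reducible image such as two adjacent points, the product is empty and hence irreducible. *)

(* Defs.v *)
From mathcomp Require Import all_boot all_order all_algebra finmap.

Set Implicit Arguments.
Unset Strict Implicit.
Unset Printing Implicit Defensive.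

Local Open Scope fset_scope.

Definition adj_or_eq (T : eqType) (k : rel T) : rel T :=
  fun x y => (x == y) || k x y.

Definition continuous (T U : eqType) (k : rel T) (l : rel U) (f : T -> U) :
    Prop :=
  forall x x' : T, k x x' -> adj_or_eq l (f x) (f x').

(* 'I_m.+1 with this relation is the digital interval [0, m] of Z. *)
Definition interval_adj (m : nat) : rel 'I_m.+1 :=
  fun s t => (s.+1 == t :> nat) || (t.+1 == s :> nat).

Definition homotopic (T U : eqType) (k : rel T) (l : rel U) (f g : T -> U) :
    Prop :=
  exists (m : nat) (F : T -> 'I_m.+1 -> U),
    [/\ 0 < m,
        forall x, F x ord0 = f x,
        forall x, F x ord_max = g x,
        forall x, continuous (@interval_adj m) l (F x)
      & forall t, continuous k l (fun x => F x t)].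

(* All images here are finite; Z^dim is encoded as integer row vectors.  The
   empty image is allowed. *)
Record digital_image := DigitalImage {
  dim : nat;
  points : {fset 'rV[int]_dim};
  adj : rel points;
  adj_sym : symmetric adj;
  adj_irr : irreflexive adj }.

Definition homotopy_equivalent (X Y : digital_image) : Prop :=
  exists (f : points X -> points Y) (g : points Y -> points X),
    [/\ continuous (@adj X) (@adj Y) f,
        continuous (@adj Y) (@adj X) g,
        homotopic (@adj X) (@adj X) (g \o f) id
      & homotopic (@adj Y) (@adj Y) (f \o g) id].

(* An image with fewer points than a finite one is itself finite, so the
   quantification over finite images is not a restriction. *)
Definition reducible (X : digital_image) : Prop :=
  exists Y : digital_image,
    homotopy_equivalent X Y /\ #|` points Y| < #|` points X|.

Definition irreducible (X : digital_image) : Prop := ~ reducible X.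

(* The Cartesian product sits in Z^(dim (X 0) + ... + dim (X (v - 1))) as the
   set of concatenations of points of the factors; submxrow x i is the i-th
   block of x. *)
Section Product.

Variables (v : nat) (X : 'I_v -> digital_image).

Definition product_points : {fset 'rV[int]_(\sum_(i < v) dim (X i))} :=
  [fset (\mxrow_(i < v) val (p i))%R
    | p : {dffun forall i : 'I_v, points (X i)} in predT].

Lemma product_pointsP (x : 'rV[int]_(\sum_(i < v) dim (X i))) :
  reflect (forall i : 'I_v, submxrow x i \in points (X i))
          (x \in product_points).
Proof.
apply: (iffP idP) => [/imfsetP[p _ ->] i | Xx].
  by rewrite mxrowK; apply: valP.
apply/imfsetP; exists [ffun i => [` Xx i]] => //.
rewrite -[LHS]submxrowK; apply: eq_mxrow => i.
by rewrite ffunE.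
Qed.

Definition coord (x : product_points) (i : 'I_v) : points (X i) :=
  [` product_pointsP _ (valP x) i].

Definition NP (u : nat) : rel product_points := fun x x' =>
  let A := [set i : 'I_v | adj (coord x i) (coord x' i)] in
  [&& x != x', 1 <= #|A| <= u & [forall (j | j \notin A), coord x j == coord x' j]].

Lemma NP_sym (u : nat) : symmetric (NP u).
Proof.
suff NPC x x' : NP u x x' -> NP u x' x by move=> x x'; apply/idP/idP; apply: NPC.
rewrite /NP eq_sym.
have -> : [set i | adj (coord x' i) (coord x i)]
        = [set i | adj (coord x i) (coord x' i)].
  by apply/setP => i; rewrite !inE adj_sym.
case/and3P=> -> -> /= /forall_inP eqx.
by apply/forall_inP => j /eqx; rewrite eq_sym.
Qed.

Lemma NP_irr (u : nat) : irreflexive (NP u).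
Proof. by move=> x; rewrite /NP eqxx. Qed.

Definition product_image (u : nat) : digital_image :=
  DigitalImage (NP_sym u) (NP_irr u).

End Product.

(* Main.v *)
(* For u = v, two points of the product are equal or adjacent iff all their
   coordinates are, so continuity can be checked coordinatewise and homotopy
   equivalences of the factors multiply to one of the products. If some factor
   were homotopy equivalent to a smaller image, replacing it would give an image
   homotopy equivalent to the product, and smaller because no other factor is
   empty. *)
Require Import Defs.
From mathcomp Require Import all_boot all_order all_algebra finmap.
From mathcomp Require Import zify.
(* [vector] shadows [coord]. *)
Import Defs.

Set Implicit Arguments.
Unset Strict Implicit.

Local Open Scope fset_scope.

Section ProductPoints.

Variables (v : nat) (X : 'I_v -> digital_image).

Lemma mxrow_product_points (p : forall i, points (X i)) :
  (\mxrow_(i < v) val (p i))%R \in product_points X.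
Proof. by apply/product_pointsP => i; rewrite mxrowK; apply: valP. Qed.

Definition product_point (p : forall i, points (X i)) : product_points X :=
  [` mxrow_product_points p].

Lemma product_pointK (p : forall i, points (X i)) (i : 'I_v) :
  coord (product_point p) i = p i.
Proof. by apply: val_inj; rewrite /= mxrowK. Qed.

Lemma coord_inj (x y : product_points X) :
  (forall i, coord x i = coord y i) -> x = y.
Proof.
move=> exy; apply: val_inj; rewrite -[LHS]submxrowK -[RHS]submxrowK.
by apply: eq_mxrow => i; have /(congr1 val) := exy i.
Qed.

(** Blocks can be recovered from their concatenation, so points of the product correspond
    bijectively to dependent families of points. *)
Lemma card_product_points :
  #|` product_points X| = \prod_(i < v) #|` points (X i)|.
Proof.
rewrite card_imfset /=; last first.
  move=> p q /eq_mxrowP epq; apply/ffunP => i.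
  by apply: val_inj; apply: epq.
rewrite -cardE card_dep_ffun foldrE big_map big_enum.
by apply: eq_bigr => i _; rewrite cardfE.
Qed.

(** With [u = v] the upper bound on the number of adjacent coordinates always holds, so only the
    lower bound separates adjacency from equality. *)
Lemma adj_or_eq_product (x y : product_points X) :
  reflect (forall i, adj_or_eq (@adj (X i)) (coord x i) (coord y i))
          (adj_or_eq (@NP v X v) x y).
Proof.
apply: (iffP idP) => [/predU1P[-> i|] | xy].
- by rewrite /adj_or_eq eqxx.
- case/and3P=> _ _ /forall_inP exy i; rewrite /adj_or_eq.
  case: (boolP (adj _ _)) => [|xyi]; first by rewrite orbT.
  by rewrite exy // inE.
rewrite /adj_or_eq; case: eqVneq => //= nxy.
rewrite /NP nxy /=; set A := [set i | _].
have exy j : j \notin A -> coord x j == coord y j.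
  by rewrite inE => /negPf nj; have := xy j; rewrite /adj_or_eq nj orbF.
apply/andP; split; last exact/forall_inP.
have -> : #|A| <= v by have := max_card A; rewrite card_ord.
rewrite andbT card_gt0.
(* If no coordinate were adjacent, all would agree and [x] would equal [y]. *)
apply: contra nxy => /eqP A0; apply/eqP/coord_inj => j; apply/eqP.
by apply: exy; rewrite A0 inE.
Qed.

End ProductPoints.

Section ProductMaps.

Variables (v : nat) (X Y : 'I_v -> digital_image).

Definition product_map (f : forall i, points (X i) -> points (Y i))
    (x : product_points X) : product_points Y :=
  product_point (fun i => f i (coord x i)).

(** Adjacent points of a product may share coordinates, and clipped times may stall, so continuity
    is needed on equal-or-adjacent pairs. *)
Lemma continuous_adj_or_eq (T U : eqType) (k : rel T) (l : rel U) (f : T -> U)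
    (x y : T) :
  continuous k l f -> adj_or_eq k x y -> adj_or_eq l (f x) (f y).
Proof. by move=> cf /predU1P[->|/cf //]; rewrite /adj_or_eq eqxx. Qed.

Lemma product_map_continuous (f : forall i, points (X i) -> points (Y i)) :
  (forall i, continuous (@adj (X i)) (@adj (Y i)) (f i)) ->
  continuous (@NP v X v) (@NP v Y v) (product_map f).
Proof.
move=> cf x y xy; apply/adj_or_eq_product => i; rewrite !product_pointK.
apply: continuous_adj_or_eq (cf i) _; apply/adj_or_eq_product.
by rewrite /adj_or_eq xy orbT.
Qed.

(* The factor homotopies may have different lengths: all are run in parallel
   over the sum of the lengths plus 1 (positive even for v = 0), each staying
   constant once it has ended. *)
Lemma product_map_homotopic (f g : forall i, points (X i) -> points (Y i)) :
  (forall i, homotopic (@adj (X i)) (@adj (Y i)) (f i) (g i)) ->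
  homotopic (@NP v X v) (@NP v Y v) (product_map f) (product_map g).
Proof.
case/fin_all_exists=> m /fin_all_exists[F HF].
pose M := (\sum_i m i).+1.
(* The minimum is at most [m i], so [inord] never falls back to its default. *)
pose clip i (t : 'I_M.+1) : 'I_(m i).+1 := inord (minn t (m i)).
have clipE i (t : 'I_M.+1) : clip i t = minn t (m i) :> nat.
  by rewrite inordK // ltnS geq_minr.
exists M, (fun x t => product_map (fun i y => F i y (clip i t)) x).
split=> // [x|x|x s t st|t].
- apply: coord_inj => i; rewrite !product_pointK.
  case: (HF i) => _ <- _ _ _; congr F.
  by apply: val_inj; rewrite /= clipE min0n.
- apply: coord_inj => i; rewrite !product_pointK.
  case: (HF i) => _ _ <- _ _; congr F.
  apply: val_inj; rewrite /= clipE; apply/minn_idPr.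
  by rewrite /= /M (bigD1 i) //= -addnS leq_addr.
- apply/adj_or_eq_product => i; rewrite !product_pointK.
  case: (HF i) => _ _ _ cF _; apply: continuous_adj_or_eq (cF _) _.
  (* Truncating two consecutive times at [m i] leaves them consecutive or makes them equal. *)
  rewrite /adj_or_eq /interval_adj -val_eqE /= !clipE.
  by move: st; rewrite /interval_adj; lia.
- by apply: product_map_continuous => i; case: (HF i).
Qed.

End ProductMaps.

(** Needed because [product_map] is shown to respect composition and identity only pointwise. *)
Lemma homotopic_ext (T U : eqType) (k : rel T) (l : rel U) (f f' g g' : T -> U) :
  f =1 f' -> g =1 g' -> homotopic k l f g -> homotopic k l f' g'.
Proof.
move=> ef eg [m [F [m0 F0 Fm cF cFt]]]; exists m, F.
by split=> // x; rewrite -?ef -?eg.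
Qed.

Lemma homotopy_equivalent_refl (X : digital_image) : homotopy_equivalent X X.
Proof.
have cid : continuous (@adj X) (@adj X) id.
  by move=> x y xy; rewrite /adj_or_eq xy orbT.
have hid : homotopic (@adj X) (@adj X) id id.
  by exists 1, (fun x _ => x); split=> // x s t _; rewrite /adj_or_eq eqxx.
by exists id, id.
Qed.

Lemma homotopy_equivalent_product (v : nat) (X Y : 'I_v -> digital_image) :
  (forall i, homotopy_equivalent (X i) (Y i)) ->
  homotopy_equivalent (product_image X v) (product_image Y v).
Proof.
case/fin_all_exists=> f /fin_all_exists[g H].
exists (product_map f), (product_map g); split.
- by apply: product_map_continuous => i; case: (H i).
- by apply: product_map_continuous => i; case: (H i).
- apply: homotopic_ext (@product_map_homotopic v X X (fun i => g i \o f i)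
    (fun=> id) _) => [x|x|i]; last by case: (H i).
  + by apply: coord_inj => i; rewrite !product_pointK.
  + by apply: coord_inj => i; rewrite !product_pointK.
- apply: homotopic_ext (@product_map_homotopic v Y Y (fun i => f i \o g i)
    (fun=> id) _) => [x|x|i]; last by case: (H i).
  + by apply: coord_inj => i; rewrite !product_pointK.
  + by apply: coord_inj => i; rewrite !product_pointK.
Qed.

Unset Implicit Arguments.
Set Strict Implicit.

(* Each factor is nonempty: with an empty factor the product is empty, hence
   irreducible, whatever the other factors are. *)
Theorem corollary3p4 (v : nat) (hv : 1 <= v) (X : 'I_v -> digital_image)
    (hX : forall i : 'I_v, points (X i) != fset0) :
  irreducible (product_image X v) -> forall i : 'I_v, irreducible (X i).
Proof.
move=> irrX i [Z [XZ ltZX]]; apply: irrX.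
pose Y j := if j == i then Z else X j.
exists (product_image Y v); split.
  apply: homotopy_equivalent_product => j; rewrite /Y.
  by case: eqP => [->|_] //; apply: homotopy_equivalent_refl.
have Yi : Y i = Z by rewrite /Y eqxx.
have YX j : j != i -> Y j = X j by rewrite /Y => /negPf ->.
(* Splitting off index [i] on both sides leaves a common positive cofactor. *)
rewrite /= !card_product_points (bigD1 i) //= [ltnRHS](bigD1 i) //= Yi.
rewrite (eq_bigr (fun j => #|` points (X j)|)) => [|j /YX -> //].
by rewrite ltn_pmul2r // prodn_cond_gt0 // => j _; rewrite cardfs_gt0.
Qed.
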